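(* Let $\Gamma$ be the infinite metric graph obtained by gluing the finite graphs $\Gamma_1,\Gamma_2,\Gamma_3,\dots$ in a chain, and let $\overline{T}$ be the infinite rooted binary tree, regarded as a metric graph, both as defined in the context. Then: (1) $\overline{T}$ does not admit a coarse embedding into $\Gamma$; (2) $\Gamma$ does not admit a coarse embedding into $\overline{T}$.
   Context: Graphs are regarded as metric spaces (with edges included as segments of length 1) equipped with the path metric. The graphs $\Gamma_n$. $\Gamma_0$ is a single edge of length $1$; its two endpoints form its pair of primary vertices. Given $\Gamma_n$, take four copies of it, indexed by $i=0,1,2,3$; in the $i$-th copy let $p_i,q_i$ be a pair of primary vertices, i.e. a pair of vertices of valence $2^n$ in $\Gamma_n$ at distance $2^n$ from each other (the same pair in each copy). $\Gamma_{n+1}$ is obtained by identifying $q_i$ with $p_{i+1}$ for all $i$ modulo $4$, and is equipped with the path metric. (So $\Gamma_1$ is a 4-cycle; for $n\ge 1$, $\Gamma_n$ has exactly two pairs of primary vertices, namely the two pairs of opposite vertices among the four gluing vertices, and $\operatorname{diam}\Gamma_n=2^n$.) The graph $\Gamma$. For each $n\ge 1$ let $p_n,q_n$ be a pair of primary vertices of $\Gamma_n$. $\Gamma$ is obtained from the disjoint union of the $\Gamma_n$ by identifying $q_n$ with $p_{n+1}$ for every $n$, with the path metric: for $x\in\Gamma_m$, $y\in\Gamma_n$ with $m<n$, $d_\Gamma(x,y)=d_{\Gamma_m}(x,q_m)+\sum_{m<k<n}2^k+d_{\Gamma_n}(p_n,y)$, and $d_\Gamma=d_{\Gamma_n}$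 on $\Gamma_n$. The tree $\overline{T}$. Let $\Omega_i=\{-1,1\}^i$ for $i\ge 0$ ($\Omega_0$ consists of the empty sequence, the root), $T_n=\bigcup_{i\le n}\Omega_i$ and $T=\bigcup_{j\ge1}T_j$. $\overline{T}$ is the graph with vertex set $T$ in which each $\sigma\in\Omega_i$ is joined by an edge of length $1$ to its two extensions $(\sigma,-1),(\sigma,1)\in\Omega_{i+1}$, with the path metric. Coarse embedding: a map $f\colon X\to Y$ between metric spaces for which there exist non-decreasing functions $\rho_-,\rho_+\colon[0,\infty)\to[0,\infty)$ with $\lim_{t\to\infty}\rho_-(t)=\infty$ and $\rho_-(d_X(x,y))\le d_Y(f(x),f(y))\le\rho_+(d_X(x,y))$ for all $x,y\in X$. *)

(* Defs.v *)
From HB Require Import structures.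
From mathcomp Require Import all_boot all_order all_algebra.
From mathcomp Require Import all_classical all_reals topology normedtype lra.

Set Implicit Arguments.
Unset Strict Implicit.
Unset Printing Implicit Defensive.

Import Order.TTheory GRing.Theory Num.Theory.
Import numFieldNormedType.Exports.

Local Open Scope classical_set_scope.
Local Open Scope ring_scope.

Inductive linked (V E : Type) (a b : E -> V) (u : V) : V -> Prop :=
| linked_refl : linked a b u u
| linked_fwd e : linked a b u (a e) -> linked a b u (b e)
| linked_bwd e : linked a b u (b e) -> linked a b u (a e).

(* A connected graph. The orientation of an edge only serves to parametrize it
   by the unit interval. *)
Record graph := Graph {
  vert : choiceType;
  edge : choiceType;
  org : edge -> vert;
  dst : edge -> vert;
  graph_connected : forall u v : vert, linked org dst u v
}.

Record pgraph := PGraph {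
  graph_of :> graph;
  ppt : vert graph_of;
  qpt : vert graph_of;
  ppt_neq_qpt : ppt != qpt
}.

Section linked_theory.
Variables (V E : Type) (a b : E -> V).

Lemma linked_trans u v w :
  linked a b u v -> linked a b v w -> linked a b u w.
Proof.
move=> uv; elim=> [//|e _ IH|e _ IH]; [exact: linked_fwd|exact: linked_bwd].
Qed.

Lemma linked_sym u v : linked a b u v -> linked a b v u.
Proof.
elim=> [|e _ IH|e _ IH]; first exact: linked_refl.
- apply: linked_trans IH; exact/linked_bwd/linked_refl.
- apply: linked_trans IH; exact/linked_fwd/linked_refl.
Qed.

End linked_theory.

(* The points of a metric graph: its vertices and, for each edge, the points
   at parameter 0 < t < 1. *)
Definition metric_graph (R : realType) (G : graph) : Type :=
  (vert G + edge G * {t : R | 0 < t < 1})%type.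

HB.instance Definition _ (R : realType) (G : graph) :=
  Choice.copy (metric_graph R G)
    (vert G + edge G * {t : R | 0 < t < 1})%type.

Section metric_graph.
Variables (R : realType) (G : graph).
Implicit Types (x y z : metric_graph R G) (e : edge G) (s t l : R).

Definition on_vert (v : vert G) : metric_graph R G := inl v.

Definition on_edge e t : metric_graph R G :=
  if insub t is Some u then inr (e, u)
  else if t <= 0 then on_vert (org e) else on_vert (dst e).

(* [polyline x y l]: there is a path of length l from x to y which is a
   concatenation of finitely many segments, each inside a closed edge. *)
Inductive polyline x : metric_graph R G -> R -> Prop :=
| polyline_nil : polyline x x 0
| polyline_cons e s t l : 0 <= s <= 1 -> 0 <= t <= 1 ->
    polyline x (on_edge e s) l -> polyline x (on_edge e t) (l + `|s - t|).

Definition path_dist x y : R := inf [set l | polyline x y l].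

Lemma on_edge0 e : on_edge e 0 = on_vert (org e).
Proof. by rewrite /on_edge insubN ?lexx// ltxx. Qed.

Lemma on_edge1 e : on_edge e 1 = on_vert (dst e).
Proof. by rewrite /on_edge insubN ?ltxx ?andbF// ler10. Qed.

Lemma on_edge_in e (u : {t : R | 0 < t < 1}) : on_edge e (val u) = inr (e, u).
Proof. by rewrite /on_edge valK. Qed.

Lemma polyline_ge0 x y l : polyline x y l -> 0 <= l.
Proof. by elim=> // e s t k _ _ _ k0; rewrite addr_ge0. Qed.

Lemma polyline_trans x y z l k :
  polyline x y l -> polyline y z k -> polyline x z (l + k).
Proof.
move=> xy; elim=> [|e s t m s01 t01 _ IH]; first by rewrite addr0.
by rewrite addrA; apply: polyline_cons.
Qed.

Lemma polyline_seg e s t : 0 <= s <= 1 -> 0 <= t <= 1 ->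
  polyline (on_edge e s) (on_edge e t) `|s - t|.
Proof.
by move=> s01 t01; rewrite -[`|_|]add0r; apply: polyline_cons => //;
  exact: polyline_nil.
Qed.

Lemma polyline_sym x y l : polyline x y l -> polyline y x l.
Proof.
elim=> [|e s t k s01 t01 _ IH]; first exact: polyline_nil.
by rewrite addrC distrC; apply: polyline_trans IH; apply: polyline_seg.
Qed.

Lemma polyline_lipschitz (f : metric_graph R G -> R) x y l :
  (forall e s t, 0 <= s <= 1 -> 0 <= t <= 1 ->
     `|f (on_edge e s) - f (on_edge e t)| <= `|s - t|) ->
  polyline x y l -> `|f x - f y| <= l.
Proof.
move=> flip; elim=> [|e s t k s01 t01 _ IH]; first by rewrite subrr normr0.
rewrite (le_trans (ler_distD (f (on_edge e s)) _ _))// lerD//.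
exact: flip.
Qed.

Lemma polyline_vert (u v : vert G) :
  exists l, polyline (on_vert u) (on_vert v) l.
Proof.
elim: (graph_connected u v) => [|e _ [l ul]|e _ [l ul]].
- by exists 0; exact: polyline_nil.
- exists (l + `|0 - 1|); rewrite -on_edge1; apply: polyline_cons;
    by rewrite ?lexx ?ler01// on_edge0.
- exists (l + `|1 - 0|); rewrite -on_edge0; apply: polyline_cons;
    by rewrite ?lexx ?ler01// on_edge1.
Qed.

Lemma polyline_to_vert x : exists v l, polyline x (on_vert v) l.
Proof.
case: x => [v|[e u]]; first by exists v, 0; exact: polyline_nil.
exists (org e), `|val u - 0|; rewrite -on_edge0 -on_edge_in.
by have /andP[u0 u1] := valP u; apply: polyline_seg;
  rewrite ?lexx ?ler01// !ltW.
Qed.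

Lemma polyline_exists x y : exists l, polyline x y l.
Proof.
have [u [k xu]] := polyline_to_vert x; have [v [m yv]] := polyline_to_vert y.
have [l uv] := polyline_vert u v.
exists (k + l + m); apply: polyline_trans (polyline_sym yv).
exact: polyline_trans xu uv.
Qed.

Lemma path_dist_le x y l : polyline x y l -> path_dist x y <= l.
Proof.
move=> xy; apply: ge_inf => //; exists 0 => k; exact: polyline_ge0.
Qed.

Lemma path_dist_ge x y l :
  (forall k, polyline x y k -> l <= k) -> l <= path_dist x y.
Proof.
move=> lxy; apply: lb_le_inf; last by move=> k /lxy.
exact: polyline_exists.
Qed.

Lemma path_distxx x : path_dist x x = 0.
Proof.
apply/eqP; rewrite eq_le path_dist_le ?path_dist_ge//; last exact: polyline_nil.
by move=> k; exact: polyline_ge0.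
Qed.

Lemma path_dist_sym x y : path_dist x y = path_dist y x.
Proof.
by congr inf; apply/seteqP; split => l /=; exact: polyline_sym.
Qed.

Lemma path_dist_triangle y x z :
  path_dist x z <= path_dist x y + path_dist y z.
Proof.
rewrite -lerBlDr; apply: path_dist_ge => k xy.
rewrite lerBlDr addrC -lerBlDr; apply: path_dist_ge => l yz.
by rewrite lerBlDr addrC; apply: path_dist_le; exact: polyline_trans xy yz.
Qed.

Lemma path_dist_lipschitz (f : metric_graph R G -> R) x y :
  (forall e s t, 0 <= s <= 1 -> 0 <= t <= 1 ->
     `|f (on_edge e s) - f (on_edge e t)| <= `|s - t|) ->
  `|f x - f y| <= path_dist x y.
Proof. by move=> flip; apply: path_dist_ge => k; exact: polyline_lipschitz. Qed.

Lemma on_edgeP (P : R -> metric_graph R G -> Prop) e :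
  P 0 (on_vert (org e)) -> P 1 (on_vert (dst e)) ->
  (forall u : {t : R | 0 < t < 1}, P (val u) (inr (e, u))) ->
  forall s, 0 <= s <= 1 -> P s (on_edge e s).
Proof.
move=> P0 P1 Pu s /andP[]; rewrite le_eqVlt => /orP[/eqP <- _|s0].
  by rewrite on_edge0.
rewrite le_eqVlt => /orP[/eqP ->|s1]; first by rewrite on_edge1.
have s01 : 0 < s < 1 by rewrite s0 s1.
by have := Pu (Sub s s01); rewrite -on_edge_in.
Qed.

Lemma max0_lipschitz (a b : R) : `|Num.max 0 a - Num.max 0 b| <= `|a - b|.
Proof.
rewrite ler_norml; case: (lerP b a) => ?;
  case: (leP 0 a) => ?; case: (leP 0 b) => ?; apply/andP; split; lra.
Qed.

Lemma path_dist_inner_gt0 e (u : {t : R | 0 < t < 1}) y :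
  inr (e, u) <> y -> 0 < path_dist (inr (e, u)) y.
Proof.
have /andP[u0 u1] := valP u.
pose c : R := val u; pose r := Num.min c (1 - c).
pose F e' (s : R) : R := if e' == e then Num.max 0 (r - `|s - c|) else 0.
pose f (z : metric_graph R G) :=
  if z is inr (e', w) then F e' (val w) else 0.
have r0 : 0 < r by rewrite /r lt_min u0 subr_gt0.
have [rc rc1] : r <= c /\ r <= 1 - c by rewrite /r !ge_min !lexx orbT.
have fE e' s : 0 <= s <= 1 -> f (on_edge e' s) = F e' s.
  move: s; apply: (@on_edgeP (fun s z => f z = F e' s)) => //=; rewrite /F;
    case: eqP => // _; rewrite max_l// subr_le0.
    by rewrite sub0r normrN ger0_norm// ltW.
  by rewrite ger0_norm// subr_ge0 ltW.
move=> xy; apply: (@lt_le_trans _ _ `|f (inr (e, u)) - f y|); last first.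
  apply: path_dist_lipschitz => e' s t s01 t01; rewrite !fE// /F.
  case: eqP => _; last by rewrite subrr normr0.
  apply: le_trans (max0_lipschitz _ _) _.
  rewrite opprB addrC addrA subrK (le_trans (ler_dist_dist _ _))//.
  by rewrite opprB addrA subrK distrC.
have -> : f (inr (e, u)) = r.
  by rewrite /f /F eqxx subrr normr0 subr0 max_r// ltW.
rewrite normr_gt0 subr_eq0; case: y xy => [v _ /=|[e' w] xy /=].
  by rewrite gt_eqF.
rewrite /F; have [ee'|_] := eqVneq e' e; last by rewrite gt_eqF.
have wu : val w != c.
  by apply/eqP => /val_inj wu; apply: xy; rewrite ee' wu.
rewrite gt_eqF// gt_max r0/= ltrBlDr ltrDl normr_gt0 subr_eq0//.
Qed.

Lemma path_dist_vert_gt0 v y : on_vert v <> y -> 0 < path_dist (on_vert v) y.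
Proof.
have half : 0 < 2^-1 :> R by rewrite invr_gt0.
have half1 : 1 - 2^-1 = 2^-1 :> R by lra.
pose F e' (s : R) : R := (if org e' == v then Num.max 0 (2^-1 - s) else 0)
  + (if dst e' == v then Num.max 0 (s - 2^-1) else 0).
pose f (z : metric_graph R G) : R :=
  match z with inl w => if w == v then 2^-1 else 0
             | inr (e', w) => F e' (val w) end.
have fE e' s : 0 <= s <= 1 -> f (on_edge e' s) = F e' s.
  move: s; apply: (@on_edgeP (fun s z => f z = F e' s)) => //=; rewrite /F.
    rewrite subr0 sub0r (max_r (ltW half)) max_l ?oppr_le0 ?ltW//.
    by case: (dst e' == v); rewrite addr0.
  rewrite half1 (max_r (ltW half)) max_l; last by lra.
  by case: (org e' == v); rewrite add0r.
move=> xy; apply: (@lt_le_trans _ _ `|f (on_vert v) - f y|); last first.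
  apply: path_dist_lipschitz => e' s t s01 t01; rewrite !fE// /F {xy f F fE}.
  case: eqP => _; case: eqP => _; rewrite ?addr0 ?add0r ?oppr0 ?subrr ?normr0//.
  - case: (leP 0 (2^-1 - s)); case: (leP 0 (s - 2^-1));
    case: (leP 0 (2^-1 - t)); case: (leP 0 (t - 2^-1));
    case: (lerP t s) => ? ? ? ? ?;
      rewrite ler_norml; apply/andP; split; lra.
  - apply: le_trans (max0_lipschitz _ _) _.
    by rewrite opprB addrC addrA subrK distrC.
  - apply: le_trans (max0_lipschitz _ _) _.
    by rewrite opprB addrA subrK.
rewrite normr_gt0 subr_eq0 /= eqxx; case: y xy => [w /= xy|[e' w] xy /=].
  have [wv|_] := eqVneq w v; last by rewrite gt_eqF.
  by exfalso; apply: xy; rewrite wv.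
rewrite gt_eqF// /F; case: w {xy f F fE} => c /= /andP[c0 c1].
move: (org e' == v) (dst e' == v) => [] [];
  case: (leP 0 (2^-1 - c)); case: (leP 0 (c - 2^-1)) => ? ?; lra.
Qed.

Lemma path_dist_positivity x y : path_dist x y = 0 -> x = y.
Proof.
move=> xy0; apply: contrapT => xy; suff : 0 < path_dist x y by rewrite xy0 ltxx.
case: x xy {xy0} => [v|[e u]]; first exact: path_dist_vert_gt0.
exact: path_dist_inner_gt0.
Qed.

HB.instance Definition _ := @isMetric.Build R (metric_graph R G)
  path_dist path_distxx path_dist_positivity path_dist_sym
  path_dist_triangle.

End metric_graph.

(* [glue next G] is the disjoint union of the graphs [G i] with [qpt (G i)]
   identified with [ppt (G (next i))] for every i. The class
   {qpt (G i), ppt (G (next i))} is represented by ppt (G (next i)), so the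
   vertices of the quotient are those of the disjoint union that are not a
   [qpt]. The last two arguments ensure that the quotient is connected. *)
Section glue.
Variables (I : choiceType) (next : I -> I) (G : I -> pgraph).
Variables (i0 : I) (next_reach : forall i, exists k, i = iter k next i0).

Let sum_vert : choiceType := {i : I & vert (G i)}.

Definition glue_rep (x : sum_vert) : bool := tagged x != qpt (G (tag x)).

Definition glue_vert : choiceType := {x : sum_vert | glue_rep x}.

Definition glue_repr (x : sum_vert) : sum_vert :=
  if glue_rep x then x
  else Tagged (fun i => vert (G i)) (ppt (G (next (tag x)))).

Lemma glue_reprP x : glue_rep (glue_repr x).
Proof. by rewrite /glue_repr; case: ifP => // _; exact: ppt_neq_qpt. Qed.

Definition glue_class (i : I) (v : vert (G i)) : glue_vert :=
  exist glue_rep _ (glue_reprP (Tagged (fun i => vert (G i)) v)).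

Definition glue_edge : choiceType := {i : I & edge (G i)}.

Definition glue_org (e : glue_edge) : glue_vert := glue_class (org (tagged e)).

Definition glue_dst (e : glue_edge) : glue_vert := glue_class (dst (tagged e)).

Lemma glue_class_qpt i :
  glue_class (qpt (G i)) = glue_class (ppt (G (next i))).
Proof.
apply: val_inj; rewrite /= /glue_repr /glue_rep /= eqxx /=.
by rewrite ppt_neq_qpt.
Qed.

Lemma glue_class_linked i (u v : vert (G i)) :
  linked glue_org glue_dst (glue_class u) (glue_class v).
Proof.
elim: (graph_connected u v) => [|e _ IH|e _ IH]; first exact: linked_refl.
- exact: (@linked_fwd _ _ glue_org glue_dst _ (Tagged (fun i => edge (G i)) e)).
- exact: (@linked_bwd _ _ glue_org glue_dst _ (Tagged (fun i => edge (G i)) e)).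
Qed.

Lemma glue_connected (u v : glue_vert) : linked glue_org glue_dst u v.
Proof.
suff h w : linked glue_org glue_dst (glue_class (ppt (G i0))) w.
  exact: linked_trans (linked_sym (h u)) (h v).
have hp i : linked glue_org glue_dst (glue_class (ppt (G i0)))
                                     (glue_class (ppt (G i))).
  have [k ->] := next_reach i; elim: k => [|k IH] /=; first exact: linked_refl.
  rewrite -glue_class_qpt; apply: linked_trans IH _; exact: glue_class_linked.
case: w => -[i w] wP; apply: linked_trans (hp i) _.
have -> : exist glue_rep (existT _ i w) wP = glue_class w :> glue_vert.
  by apply: val_inj; rewrite /= /glue_repr wP.
exact: glue_class_linked.
Qed.

Definition glue : graph := Graph glue_connected.

End glue.

Lemma interval_connected (u v : bool) :
  linked (fun _ : unit => false) (fun _ : unit => true) u v.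
Proof.
suff h w : linked (fun _ : unit => false) (fun _ : unit => true) false w.
  exact: linked_trans (linked_sym (h u)) (h v).
by case: w; [exact: (linked_fwd (e := tt) (linked_refl _ _ _))|
             exact: linked_refl].
Qed.

Definition interval : graph := Graph interval_connected.

Lemma ordS4_reach (i : 'I_4) : exists k, i = iter k (@ordS 4) ord0.
Proof. by exists i; apply: val_inj; case: i => -[|[|[|[|]]]]. Qed.

Definition four_cycle (G : pgraph) : graph :=
  glue (fun _ : 'I_4 => G) ordS4_reach.

(* The image in [four_cycle G] of the vertex p_i of the i-th copy of G. *)
Definition four_cycle_pt (G : pgraph) (i : 'I_4) : vert (four_cycle G) :=
  glue_class (@ordS 4) (G := fun _ => G) (i := i) (ppt G).

Definition i0_4 : 'I_4 := @Ordinal 4 0 isT.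
Definition i2_4 : 'I_4 := @Ordinal 4 2 isT.

Lemma four_cycle_pt_neq (G : pgraph) :
  four_cycle_pt G i0_4 != four_cycle_pt G i2_4.
Proof.
apply/eqP => /(congr1 (fun x => tag (val x))) /=.
by rewrite /glue_repr /glue_rep /= ppt_neq_qpt.
Qed.

(* The graph Gamma_n with one of its pairs of primary vertices: for n >= 1, the
   opposite gluing vertices p_0 and p_2. A cyclic permutation of the four
   copies is an automorphism of Gamma_n, and these automorphisms carry
   (p_0, p_2) to any other (ordered) pair of primary vertices. *)
Fixpoint Gamma_ (n : nat) : pgraph :=
  if n is m.+1 then PGraph (four_cycle_pt_neq (Gamma_ m))
  else @PGraph interval false true isT.

Lemma succn_reach (n : nat) : exists k, n = iter k succn 0%N.
Proof. by exists n; elim: n => //= n <-. Qed.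

Definition Gamma_graph : graph := glue (fun n => Gamma_ n.+1) succn_reach.

Definition Gamma (R : realType) : metricType R := metric_graph R Gamma_graph.

(* The elements of {-1, 1} are encoded as booleans; the edge (s, b) joins s to
   its extension by b. *)
Lemma binary_tree_connected (u v : seq bool) :
  linked (fun e : seq bool * bool => e.1) (fun e => rcons e.1 e.2) u v.
Proof.
suff h w :
    linked (fun e : seq bool * bool => e.1) (fun e => rcons e.1 e.2) [::] w.
  exact: linked_trans (linked_sym (h u)) (h v).
elim/last_ind: w => [|w b IH]; first exact: linked_refl.
exact: (@linked_fwd _ _ (fun e : seq bool * bool => e.1) _ _ (w, b)).
Qed.

Definition binary_tree : graph := Graph binary_tree_connected.

Definition Tbar (R : realType) : metricType R := metric_graph R binary_tree.

Definition coarse_embedding (R : realType) (X Y : metricType R) (f : X -> Y) :=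
  exists rho_m rho_p : R -> R,
    [/\ (forall t, 0 <= t -> 0 <= rho_m t) /\ (forall t, 0 <= t -> 0 <= rho_p t),
        {in >= 0 &, {homo rho_m : s t / s <= t}} /\
        {in >= 0 &, {homo rho_p : s t / s <= t}},
        rho_m t @[t --> +oo] --> +oo &
        forall x y, rho_m (mdist x y) <= mdist (f x) (f y) <= rho_p (mdist x y)].

(* Main.v *)
(** If every path from u to v meets a set A of vertices, then
  d(u, v) >= d(u, A). Up to moving images to nearby vertices, a coarse embedding
  is a map g between vertex sets.

  (1) The gluing vertex q_n of Gamma separates a finite part from the rest, so g
  sends points of both rays (-1, -1, ...) and (1, 1, ...) near q_n. These points
  are then at bounded distance from each other, hence from the root, so q_n
  stays at bounded distance from the image of the root for all large n: absurd.

  (2) Two far apart points of the tree are separated by a vertex w far from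
  both. Apply this to the images of the primary vertices a, c of Gamma_(n+1):
  each of the two halves of Gamma_(n+1) joining a to c has a point sent near w.
  These two points are at bounded distance from each other, hence the first one
  from {a, c}, which brings w near g a or g c: absurd. *)

Require Import Defs.
From mathcomp Require Import all_boot all_order all_algebra.
From mathcomp Require Import all_classical all_reals topology normedtype.
From mathcomp Require Import lra zify.

Set Implicit Arguments.
Unset Strict Implicit.
Unset Printing Implicit Defensive.

Import Order.TTheory GRing.Theory Num.Theory.

Local Open Scope classical_set_scope.
Local Open Scope ring_scope.

Lemma linked_cross (V E : Type) (a b : E -> V) (P : pred V) u v :
  linked a b u v -> P u != P v -> exists e, P (a e) != P (b e).
Proof.
elim=> [|e _ IH|e _ IH]; first by rewrite eqxx.
- by have [/IH//|/negPn/eqP -> ?] := boolP (P u != P (a e)); exists e.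
- have [/IH//|/negPn/eqP -> ?] := boolP (P u != P (b e)); exists e.
  by rewrite eq_sym.
Qed.

Lemma finite_fun_ubound (R : realType) (T : eqType) (A : set T) (f : T -> R) :
  finite_set A -> exists M, forall x, A x -> f x <= M.
Proof.
move=> /finite_seqP[s ->]; exists (\big[Num.max/0]_(x <- s) f x) => x xs.
exact: le_bigmax_seq.
Qed.

Section vertex_distance.
Variables (R : realType) (G : graph).
Implicit Types (u v w : vert G) (e : edge G) (phi : vert G -> R).

Definition vdist u v : R := path_dist (on_vert R u) (on_vert R v).

Definition edge_lipschitz phi :=
  forall e, `|phi (org e) - phi (dst e)| <= 1.

Lemma vdistxx u : vdist u u = 0.
Proof. exact: path_distxx. Qed.

Lemma vdist_sym u v : vdist u v = vdist v u.
Proof. exact: path_dist_sym. Qed.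

Lemma vdist_triangle v u w : vdist u w <= vdist u v + vdist v w.
Proof. exact: path_dist_triangle. Qed.

Lemma vdist_ge0 u v : 0 <= vdist u v.
Proof. by apply: path_dist_ge => k; exact: polyline_ge0. Qed.

Lemma vdist_edge e : vdist (org e) (dst e) <= 1.
Proof.
have -> : 1 = `|0 - 1| :> R by rewrite sub0r normrN1.
rewrite /vdist -on_edge0 -on_edge1; apply: path_dist_le.
by apply: polyline_seg; rewrite ?lexx ?ler01.
Qed.

Lemma vdist_edge_lipschitz u : edge_lipschitz (vdist u).
Proof.
move=> e; have := vdist_triangle (dst e) u (org e).
have := vdist_triangle (org e) u (dst e); rewrite (vdist_sym (dst e)).
by have := vdist_edge e; rewrite ler_norml => ? ? ?; apply/andP; split; lra.
Qed.

(* The affine extension of [phi] to the edges is 1-Lipschitz. *)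
Lemma edge_lipschitz_vdist phi u v :
  edge_lipschitz phi -> phi v - phi u <= vdist u v.
Proof.
move=> phiL.
pose F e (s : R) : R := (1 - s) * phi (org e) + s * phi (dst e).
pose f (z : metric_graph R G) : R :=
  match z with inl w => phi w | inr (e, s) => F e (val s) end.
have fE e s : 0 <= s <= 1 -> f (on_edge e s) = F e s.
  by move: s; apply: (@on_edgeP _ _ (fun s z => f z = F e s)) => //=;
    rewrite /F; lra.
apply: le_trans (ler_norm _) _; rewrite vdist_sym.
apply: (@path_dist_lipschitz R G f (on_vert R v) (on_vert R u)) =>
  e s t s01 t01; rewrite !fE//.
have -> : F e s - F e t = (phi (org e) - phi (dst e)) * (t - s).
  by rewrite /F; lra.
by rewrite normrM (distrC s t) ler_piMl.
Qed.

Lemma vdist1_cross (P : pred (vert G)) u v : P u != P v ->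
  exists x y, [/\ P x, ~~ P y & vdist x y <= 1].
Proof.
move=> /(linked_cross (graph_connected u v))[e].
have [Po|Po] := boolP (P (org e)); have [Pd|Pd] := boolP (P (dst e)) => // _.
  by exists (org e), (dst e); split=> //; exact: vdist_edge.
by exists (dst e), (org e); split=> //; rewrite vdist_sym vdist_edge.
Qed.

Definition cuts (A S : {pred vert G}) :=
  forall e, S (org e) != S (dst e) -> (org e \in A) || (dst e \in A).

(* The function equal to [Num.min r (vdist u x)] on [S] and to [r] elsewhere is
   1-Lipschitz. *)
Lemma cut_vdist (A S : {pred vert G}) (r : R) u v : cuts A S ->
  {in A, forall a, r <= vdist u a} -> S u -> ~~ S v -> r <= vdist u v.
Proof.
move=> cutS uA Su /negbTE Sv.
pose phi x := if S x then Num.min r (vdist u x) else r.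
have phiL : edge_lipschitz phi.
  move=> e; have := vdist_edge_lipschitz u e.
  have near_A : S (org e) != S (dst e) ->
      r <= vdist u (org e) \/ r <= vdist u (dst e).
    by move=> /cutS/orP[/uA|/uA]; [left|right].
  rewrite !ler_norml /phi; case: (S (org e)) (S (dst e)) near_A => [] [] near_A.
  - by case: (leP r (vdist u (org e))); case: (leP r (vdist u (dst e))); lra.
  - by case: (leP r (vdist u (org e))) (near_A isT) => ? [] ? ?; lra.
  - by case: (leP r (vdist u (dst e))) (near_A isT) => ? [] ? ?; lra.
  - by rewrite subrr; lra.
have := edge_lipschitz_vdist u v phiL; rewrite /phi Su Sv vdistxx.
by case: (leP r 0); lra.
Qed.

Lemma cut1_vdist (S : {pred vert G}) a u v : cuts (pred1 a) S ->
  S u -> ~~ S v -> vdist u a <= vdist u v.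
Proof. by move=> cutS; apply: cut_vdist cutS _ => b /eqP ->. Qed.

Lemma cut2_vdist (S : {pred vert G}) a b u v : cuts (pred2 a b) S ->
  S u -> ~~ S v -> vdist u a <= vdist u v \/ vdist u b <= vdist u v.
Proof.
move=> cutS Su Sv; apply/orP; rewrite -ge_min; apply: cut_vdist cutS _ Su Sv.
by move=> c /pred2P[] ->; rewrite ge_min lexx ?orbT.
Qed.

End vertex_distance.

Arguments vdist R {G} u v.
Arguments vdist_triangle {R G} v u w.

Lemma edge_nonexpanding_vdist (R : realType) (G H : graph)
    (h : vert G -> vert H) u v :
  (forall e, vdist R (h (org e)) (h (dst e)) <= 1) ->
  vdist R (h u) (h v) <= vdist R u v.
Proof.
move=> h1; rewrite -[leLHS]subr0 -(vdistxx R (h u)).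
apply: (@edge_lipschitz_vdist R G (fun x => vdist R (h u) (h x))) => e.
have := vdist_triangle (h (dst e)) (h u) (h (org e)) : _ <= _ :> R.
have := vdist_triangle (h (org e)) (h u) (h (dst e)) : _ <= _ :> R.
rewrite (vdist_sym _ (h (dst e))) ler_norml => ? ?.
by have ? := h1 e; apply/andP; split; lra.
Qed.

Section coarse_maps.
Variable R : realType.

Definition bornologous (X Y : Type) (dX : X -> X -> R) (dY : Y -> Y -> R)
    (f : X -> Y) :=
  forall D, exists K, forall x y, dX x y <= D -> dY (f x) (f y) <= K.

Definition effectively_proper (X Y : Type) (dX : X -> X -> R)
    (dY : Y -> Y -> R) (f : X -> Y) :=
  forall K, exists D, forall x y, dY (f x) (f y) <= K -> dX x y <= D.

Lemma coarse_embedding_bornologous (X Y : metricType R) (f : X -> Y) :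
  coarse_embedding f -> bornologous mdist mdist f.
Proof.
move=> [rm [rp [_ [_ rp_homo] _ fE]]] D; exists (rp D) => x y xyD.
have /andP[_ /le_trans] := fE x y; apply; apply: rp_homo => //.
  exact: mdist_ge0.
exact: le_trans (mdist_ge0 x y) xyD.
Qed.

Lemma coarse_embedding_effectively_proper (X Y : metricType R) (f : X -> Y) :
  coarse_embedding f -> effectively_proper mdist mdist f.
Proof.
move=> [rm [rp [_ _ /cvgryPgt rm_oo fE]]] K.
have [D [_ rmD]] := rm_oo K; exists D => x y fxyK.
rewrite leNgt; apply/negP => /rmD /=; apply/negP; rewrite -leNgt.
by have /andP[/le_trans rm_le _] := fE x y; exact: rm_le.
Qed.

Definition nearest_vert (G : graph) (x : metric_graph R G) : vert G :=
  match x with inl v => v | inr (e, _) => org e end.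

Lemma nearest_vert_dist (G : graph) (x : metric_graph R G) :
  path_dist x (on_vert R (nearest_vert x)) <= 1.
Proof.
case: x => [v|[e s]] /=; first by rewrite path_distxx.
have /andP[/ltW s0 /ltW s1] := valP s.
rewrite -on_edge0 -on_edge_in; apply: (@le_trans _ _ `|val s - 0|).
  by apply/path_dist_le/polyline_seg; rewrite ?lexx ?ler01 ?s0.
by rewrite subr0 ger0_norm.
Qed.

Section vert_map.
Variables (G H : graph) (f : metric_graph R G -> metric_graph R H).

Definition vert_map (v : vert G) : vert H := nearest_vert (f (on_vert R v)).

Lemma vert_map_close u v : `|vdist R (vert_map u) (vert_map v)
  - path_dist (f (on_vert R u)) (f (on_vert R v))| <= 2.
Proof.
set x := f (on_vert R u); set y := f (on_vert R v).
have := nearest_vert_dist x; have := nearest_vert_dist y.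
rewrite /vdist -/(vert_map u) -/(vert_map v).
set x' := on_vert R (vert_map u); set y' := on_vert R (vert_map v).
have := path_dist_triangle x x' y'; have := path_dist_triangle y x y'.
have := path_dist_triangle x' x y; have := path_dist_triangle y' x' y.
rewrite (path_dist_sym x' x) (path_dist_sym y' y) ler_norml => *.
by apply/andP; split; lra.
Qed.

Lemma vert_map_bornologous : bornologous (@path_dist R G) (@path_dist R H) f ->
  bornologous (vdist R) (vdist R) vert_map.
Proof.
move=> fB D; have [K fK] := fB D; exists (K + 2) => u v /fK.
by have := vert_map_close u v; rewrite ler_norml => /andP[_]; lra.
Qed.

Lemma vert_map_effectively_proper :
  effectively_proper (@path_dist R G) (@path_dist R H) f ->
  effectively_proper (vdist R) (vdist R) vert_map.
Proof.
move=> fP K; have [D fD] := fP (K + 2); exists D => u v uvK; apply: fD.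
by have := vert_map_close u v; rewrite ler_norml => /andP[+ _]; lra.
Qed.

End vert_map.

Lemma coarse_embedding_vert (G H : graph)
    (f : (metric_graph R G : metricType R) ->
         (metric_graph R H : metricType R)) :
  coarse_embedding f -> exists g : vert G -> vert H,
    bornologous (vdist R) (vdist R) g /\
    effectively_proper (vdist R) (vdist R) g.
Proof.
move=> fC; exists (vert_map f); split.
  exact/vert_map_bornologous/coarse_embedding_bornologous.
exact/vert_map_effectively_proper/coarse_embedding_effectively_proper.
Qed.

End coarse_maps.

Section glue_theory.
Variables (I : choiceType) (next : I -> I) (G : I -> pgraph).

Definition glue_lift (T : Type) (phi : forall i, vert (G i) -> T)
  (x : glue_vert G) : T := phi (tag (val x)) (tagged (val x)).

Definition glue_compatible (T : Type) (phi : forall i, vert (G i) -> T) :=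
  forall i, phi i (qpt (G i)) = phi (next i) (ppt (G (next i))).

Lemma glue_liftE (T : Type) (phi : forall i, vert (G i) -> T) i
    (v : vert (G i)) :
  glue_compatible phi -> glue_lift phi (glue_class next v) = phi i v.
Proof.
move=> phiq; rewrite /glue_lift /= /glue_repr /glue_rep /=.
by case: eqP => //= ->.
Qed.

Lemma glue_class_tagged (x : glue_vert G) :
  glue_class next (tagged (val x)) = x.
Proof.
by case: x => -[i v] vP; apply: val_inj; rewrite /= /glue_repr vP.
Qed.

Lemma tag_glue_class i (v : vert (G i)) :
  tag (val (glue_class next v)) = if v == qpt (G i) then next i else i.
Proof. by rewrite /= /glue_repr /glue_rep /=; case: eqP. Qed.

Lemma finite_glue_tag (J : set I) : finite_set J ->
  (forall i, finite_set [set: vert (G i)]) ->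
  finite_set [set x : glue_vert G | J (tag (val x))].
Proof.
move=> Jfin Gfin.
apply: (@sub_finite_set _ _ (\bigcup_(i in J) range (@glue_class _ next G i))).
  by move=> x Jx; exists (tag (val x)) => //; exists (tagged (val x)) => //;
    exact: glue_class_tagged.
by apply: bigcup_finite => // i _; exact: finite_image.
Qed.

Lemma vdist_glue_class (R : realType) (i0 : I)
    (reach : forall i, exists k, i = iter k next i0) i (u v : vert (G i)) :
  @vdist R (Defs.glue G reach) (glue_class next u) (glue_class next v)
  <= vdist R u v.
Proof.
apply: (@edge_nonexpanding_vdist R (G i) (Defs.glue G reach)) => e.
exact: (@vdist_edge R (Defs.glue G reach) (Tagged (fun i => edge (G i)) e)).
Qed.

End glue_theory.

Section tree.
Variable R : realType.
Implicit Types (p s u v w : seq bool).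
Local Notation tdist := (@vdist R binary_tree).

Lemma prefix_rcons_neq w s (b : bool) :
  prefix w s != prefix w (rcons s b) -> w = rcons s b.
Proof.
elim: w s => [|a w IH] [|c s] /=; rewrite ?prefix0s ?eqxx//.
- by case: (a =P b) => //= ->; case: w {IH}.
- by case: (a =P c) => //= -> /IH ->.
Qed.

Lemma subtree_cut w : @cuts binary_tree (pred1 w) (prefix w).
Proof.
by move=> [s b] /prefix_rcons_neq ->; apply/orP; right; rewrite inE.
Qed.

Lemma subtree_cut_parent w b : @cuts binary_tree (pred1 w) (prefix (rcons w b)).
Proof.
by move=> [s c] /prefix_rcons_neq/rcons_inj[-> _]; apply/orP; left; rewrite inE.
Qed.

Lemma tree_vdist_size u v : (size v)%:R - (size u)%:R <= tdist u v.
Proof.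
apply: (@edge_lipschitz_vdist R binary_tree (fun s => (size s)%:R)).
by move=> [s b] /=; rewrite size_rcons -natr1 ler_norml; apply/andP; lra.
Qed.

Lemma tree_vdist_cat p s : tdist p (p ++ s) <= (size s)%:R.
Proof.
elim/last_ind: s => [|s b IH]; first by rewrite cats0 vdistxx.
rewrite size_rcons -natr1 -rcons_cat.
apply: le_trans (vdist_triangle (p ++ s : vert binary_tree) _ _) _.
by apply: lerD IH _; exact: (@vdist_edge R binary_tree (p ++ s, b)).
Qed.

Lemma opposite_rays_vdist (b : bool) i j :
  tdist (nseq i b) [::] <= tdist (nseq i b) (nseq j (~~ b)).
Proof.
case: i => [|i]; first by rewrite vdistxx vdist_ge0.
apply: (cut1_vdist R (@subtree_cut_parent [::] b)).
  by rewrite /= eqxx prefix0s.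
by case: j => //= j; rewrite prefix0s andbT; case: b.
Qed.

(* The separating vertex is the ancestor at distance [n] of the deeper of the
   two points. *)
Lemma tree_separation (n : nat) u v : n.*2%:R < tdist u v ->
  exists (S : {pred vert binary_tree}) (w : vert binary_tree),
    [/\ cuts (pred1 w) S, S u != S v, n%:R <= tdist w u & n%:R <= tdist w v].
Proof.
wlog vu : u v / (size v <= size u)%N => [sep|far].
  have [/sep//|/ltnW/sep uv_sep] := leqP (size v) (size u).
  rewrite vdist_sym => /uv_sep[S [w [cutS Suv wv wu]]].
  by exists S, w; split=> //; rewrite eq_sym.
pose w := take (size u - n) u.
have sizew : size w = (size u - n)%N by rewrite size_takel// leq_subr.
have wu_le : tdist w u <= n%:R.
  rewrite -[X in tdist _ X](cat_take_drop (size u - n)).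
  by apply: le_trans (tree_vdist_cat _ _) _; rewrite ler_nat size_drop; lia.
have triangle : tdist u v <= tdist w u + tdist w v.
  by rewrite (@vdist_sym R binary_tree w u); exact: vdist_triangle.
rewrite -addnn natrD in far.
have w_notin_v : ~~ prefix w v.
  apply/negP => /prefixP[t vE]; have : tdist w v <= n%:R.
    rewrite vE; apply: le_trans (tree_vdist_cat _ _) _; rewrite ler_nat.
    by rewrite vE size_cat sizew in vu; lia.
  by lra.
have nu : (n <= size u)%N.
  rewrite leqNgt; apply: contra w_notin_v => /ltnW.
  by rewrite -subn_eq0 /w => /eqP ->; rewrite take0 prefix0s.
exists (prefix w), w; split; first exact: subtree_cut.
- by rewrite prefix_take (negbTE w_notin_v).
- apply: le_trans (tree_vdist_size _ _).
  by rewrite sizew -natrB ?leq_subr// subKn.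
- by lra.
Qed.

End tree.

Section four_cycle_theory.
Variables (R : realType) (G : pgraph).

Definition four_cycle_pgraph : pgraph := PGraph (four_cycle_pt_neq G).

Local Notation C4 := four_cycle_pgraph.

Definition cycle_pt (i : 'I_4) (v : vert G) : vert C4 :=
  glue_class (@ordS 4) (G := fun=> G) (i := i) v.

Lemma cycle_pt_qpt i : cycle_pt i (qpt G) = cycle_pt (ordS i) (ppt G).
Proof. exact: glue_class_qpt. Qed.

Lemma cycle_pt_vdist i u v :
  vdist R (cycle_pt i u) (cycle_pt i v) <= vdist R u v.
Proof. exact: vdist_glue_class. Qed.

Lemma finite_four_cycle :
  finite_set [set: vert G] -> finite_set [set: vert C4].
Proof.
move=> Gfin; apply: (@finite_glue_tag _ (@ordS 4) (fun=> G) setT) => //.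
exact: finite_finset.
Qed.

(* The potential [psi] folds the cycle onto a segment: it climbs along the
   copies 0 and 1 and comes down along the copies 2 and 3. *)
Lemma four_cycle_width :
  2 * vdist R (ppt G) (qpt G) <= vdist R (ppt C4) (qpt C4).
Proof.
pose d v := vdist R (ppt G) v; pose D := d (qpt G).
have d0 : d (ppt G) = 0 by exact: vdistxx.
pose psi (i : 'I_4) v : R :=
  match val i with
  | 0%N => d v | 1%N => D + d v | 2%N => 2 * D - d v | _ => D - d v
  end.
have psiC : glue_compatible (G := fun=> G) (@ordS 4) psi.
  by case=> -[|[|[|[|]]]]// ilt; rewrite /psi /= d0 -/D; lra.
have psiE i v : glue_lift (G := fun=> G) psi (cycle_pt i v) = psi i v.
  exact: glue_liftE psiC.
have psiL : @edge_lipschitz R C4 (glue_lift (G := fun=> G) psi).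
  move=> [i e].
  rewrite -[org _]/(cycle_pt i (org e)) -[dst _]/(cycle_pt i (dst e)) !psiE.
  have := vdist_edge_lipschitz R (ppt G) e; rewrite !ler_norml.
  rewrite -/(d _) -/(d _) => /andP[? ?].
  by case: i => -[|[|[|[|]]]]// ilt; rewrite /psi /=; apply/andP; lra.
have := edge_lipschitz_vdist (ppt C4) (qpt C4) psiL.
by rewrite /= /four_cycle_pt -!/(cycle_pt _ _) !psiE /psi /= d0 -/D; lra.
Qed.

Definition half_cycle (i : 'I_4) : set (vert C4) :=
  range (cycle_pt i) `|` range (cycle_pt (ordS i)).

Lemma half_cycle_cross i j (P : pred (vert C4)) : j = ordS (ordS i) ->
  P (cycle_pt i (ppt G)) != P (cycle_pt j (ppt G)) ->
  exists x y, [/\ half_cycle i x, P x, ~~ P y & vdist R x y <= 1].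
Proof.
move=> ->.
have copy_cross k : P (cycle_pt k (ppt G)) != P (cycle_pt (ordS k) (ppt G)) ->
    exists x y, [/\ range (cycle_pt k) x, P x, ~~ P y & vdist R x y <= 1].
  rewrite -cycle_pt_qpt.
  move=> /(@vdist1_cross R G (P \o cycle_pt k))[x [y [Px Py xy1]]].
  exists (cycle_pt k x), (cycle_pt k y); split=> //.
  exact: le_trans (cycle_pt_vdist _ _ _) xy1.
have [/copy_cross[x [y [? ? ? ?]]] _|/negPn/eqP ->] :=
    boolP (P (cycle_pt i (ppt G)) != P (cycle_pt (ordS i) (ppt G))).
  by exists x, y; split=> //; left.
by move=> /copy_cross[x [y [? ? ? ?]]]; exists x, y; split=> //; right.
Qed.

Definition primary : {pred vert C4} := pred2 (ppt C4) (qpt C4).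

(* The non-primary vertices of the copies 0 and 1: a gluing vertex is
   represented in the copy of which it is the [ppt]. *)
Definition open_half_cycle : {pred vert C4} :=
  fun x => (x \notin primary) && (tag (val x) < 2)%N.

Lemma open_half_cycle_pt i v : cycle_pt i v \notin primary ->
  open_half_cycle (cycle_pt i v) = (i < 2)%N.
Proof.
move=> npri; rewrite /open_half_cycle npri /= -/(cycle_pt i v).
rewrite /cycle_pt tag_glue_class; have [vq|//] := eqVneq v (qpt G).
move: npri; rewrite vq cycle_pt_qpt => npri.
have : (ordS i != i0_4) && (ordS i != i2_4).
  by rewrite -negb_or; apply: contra npri => /orP[]/eqP ->;
    rewrite !inE eqxx ?orbT.
by case: i {vq npri} => -[|[|[|[|]]]].
Qed.

Lemma open_half_cycle_cut : cuts primary open_half_cycle.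
Proof.
move=> [i e].
rewrite -[org _]/(cycle_pt i (org e)) -[dst _]/(cycle_pt i (dst e)).
by apply: contraNT; rewrite negb_or => /andP[? ?]; rewrite !open_half_cycle_pt.
Qed.

Lemma opposite_halves_vdist x y :
  half_cycle i0_4 x -> half_cycle i2_4 y ->
  vdist R x (ppt C4) <= vdist R x y \/ vdist R x (qpt C4) <= vdist R x y.
Proof.
move=> x_half y_half.
have [/pred2P[]->|x_npri] := boolP (x \in primary);
  rewrite ?vdistxx ?vdist_ge0; [by left|by right|].
apply: (cut2_vdist R open_half_cycle_cut).
  by case: x_half x_npri => -[v _ <-] /open_half_cycle_pt ->.
have [y_pri|y_npri] := boolP (y \in primary).
  by rewrite /open_half_cycle y_pri.
by case: y_half y_npri => -[v _ <-] /open_half_cycle_pt ->.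
Qed.

End four_cycle_theory.

Lemma four_cycle_tree_primary_bound (R : realType) (G : pgraph)
    (h : vert (four_cycle_pgraph G) -> vert binary_tree) (C D K : R) (m : nat) :
  (forall x y, vdist R x y <= 1 -> vdist R (h x) (h y) <= C) ->
  (forall x y, vdist R (h x) (h y) <= C + C -> vdist R x y <= D) ->
  (forall x y, vdist R x y <= D -> vdist R (h x) (h y) <= K) ->
  C + K < m%:R ->
  vdist R (h (ppt (four_cycle_pgraph G))) (h (qpt (four_cycle_pgraph G)))
  <= m.*2%:R.
Proof.
move=> hC hD hK CKm; rewrite leNgt; apply/negP.
move=> /tree_separation[S [w [cutS Spq wp wq]]].
have near_w x y : S (h x) -> ~~ S (h y) -> vdist R x y <= 1 ->
    vdist R (h x) w <= C.
  by move=> Sx Sy /hC; apply: le_trans; exact: (cut1_vdist R cutS).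
have opposite0 : i2_4 = ordS (ordS i0_4) by exact: val_inj.
have opposite2 : i0_4 = ordS (ordS i2_4) by exact: val_inj.
have [x [x' [x_half Sx Sx' /(near_w _ _ Sx Sx') xw]]] :=
  @half_cycle_cross R G i0_4 i2_4 (S \o h) opposite0 Spq.
have Sqp : S (h (qpt _)) != S (h (ppt _)) by rewrite eq_sym.
have [y [y' [y_half Sy Sy' /(near_w _ _ Sy Sy') yw]]] :=
  @half_cycle_cross R G i2_4 i0_4 (S \o h) opposite2 Sqp.
have xyD : vdist R x y <= D.
  apply/hD/(le_trans (vdist_triangle w _ _)).
  by rewrite (vdist_sym R w) lerD.
have h_far z : m%:R <= vdist R w (h z) -> ~ vdist R x z <= D.
  move=> wz /hK xzK; have := vdist_triangle (h x) w (h z) : _ <= _ :> R.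
  by rewrite (vdist_sym R w (h x)); lra.
have [/le_trans/(_ xyD)|/le_trans/(_ xyD)] :=
    opposite_halves_vdist R x_half y_half; exact: h_far.
Qed.

Section chain_theory.
Variables (R : realType) (G : nat -> pgraph).

Definition chain : graph := Defs.glue G succn_reach.

Definition chain_pt (n : nat) (v : vert (G n)) : vert chain :=
  glue_class succn v.

Definition chain_tag (x : vert chain) : nat := tag (val x).

Lemma chain_tag_pt n (v : vert (G n)) :
  chain_tag (chain_pt v) = if v == qpt (G n) then n.+1 else n.
Proof. exact: tag_glue_class. Qed.

Lemma chain_tag_vdist x y :
  (chain_tag y)%:R - (chain_tag x)%:R <= vdist R x y.
Proof.
apply: (@edge_lipschitz_vdist R chain (fun x => (chain_tag x)%:R)) => -[n e].
rewrite -[org _]/(chain_pt (org e)) -[dst _]/(chain_pt (dst e)) !chain_tag_pt.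
by case: eqP; case: eqP => _ _; rewrite -?natr1 ler_norml; apply/andP; lra.
Qed.

Lemma chain_cut n :
  cuts (pred1 (chain_pt (qpt (G n)))) [pred x | (chain_tag x <= n)%N].
Proof.
move=> [k e]; rewrite -[org _]/(chain_pt (org e)) -[dst _]/(chain_pt (dst e)).
rewrite !inE /= !chain_tag_pt.
have [->|_] := eqVneq (org e) (qpt _); have [->|_] := eqVneq (dst e) (qpt _);
  rewrite ?eqxx// => cross; have -> : n = k by lia.
- by rewrite eqxx.
- by rewrite eqxx orbT.
Qed.

Lemma chain_crossing_near (x : nat -> vert chain) (C : R) n :
  (forall i, vdist R (x i) (x i.+1) <= C) -> (chain_tag (x 0) <= n)%N ->
  (exists i, n < chain_tag (x i))%N ->
  exists i, vdist R (x i) (chain_pt (qpt (G n))) <= C.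
Proof.
move=> xC x0n exit; case: (ex_minnP exit) => -[|i] xi imin.
  by rewrite ltnNge x0n in xi.
exists i; apply: le_trans (xC i); apply: (cut1_vdist R (@chain_cut n)) => /=.
  by rewrite leqNgt; apply/negP => /imin; rewrite ltnn.
by rewrite -ltnNge.
Qed.

Lemma chain_tag_bounded x n : (forall k, finite_set [set: vert (G k)]) ->
  exists B, forall y, (chain_tag y <= n)%N -> vdist R x y <= B.
Proof.
move=> Gfin; apply: (@finite_fun_ubound _ _ [set y | (chain_tag y <= n)%N]).
exact: (@finite_glue_tag _ succn G `I_n.+1).
Qed.

Definition piece_retract n (k : nat) (v : vert (G k)) : vert (G n) :=
  if (k < n)%N then ppt (G n) else if (n < k)%N then qpt (G n)
  else tagged_as (Tagged (fun i => vert (G i)) (ppt (G n)))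
                 (Tagged (fun i => vert (G i)) v).

Lemma piece_retract_id n (v : vert (G n)) : piece_retract n v = v.
Proof. by rewrite /piece_retract ltnn tagged_asE. Qed.

Definition chain_retract n : vert chain -> vert (G n) :=
  glue_lift (@piece_retract n).

Lemma chain_retract_pt n k (v : vert (G k)) :
  chain_retract n (chain_pt v) = piece_retract n v.
Proof.
apply: (glue_liftE (next := succn)) => i; rewrite /piece_retract ltnS.
have [i_lt|n_lt|<-] := ltngtP i n.
- have [//|n_le] := ltnP i.+1 n.
  have -> : n = i.+1 by apply/eqP; rewrite eqn_leq n_le i_lt.
  by rewrite tagged_asE.
- by rewrite ltnNge (leqW (ltnW n_lt)).
- by rewrite ltnNge leqnSn tagged_asE.
Qed.

Lemma chain_retract_vdist n x y :
  vdist R (chain_retract n x) (chain_retract n y) <= vdist R x y.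
Proof.
apply: edge_nonexpanding_vdist => -[k e].
rewrite -[org _]/(chain_pt (org e)) -[dst _]/(chain_pt (dst e)).
rewrite !chain_retract_pt; have [kn|nk|kn] := ltngtP k n.
- by rewrite /piece_retract kn vdistxx.
- by rewrite /piece_retract nk ltnNge (ltnW nk) vdistxx.
- by subst k; rewrite !piece_retract_id vdist_edge.
Qed.

Lemma chain_pt_isometry n (u v : vert (G n)) :
  vdist R (chain_pt u) (chain_pt v) = vdist R u v.
Proof.
apply/eqP; rewrite eq_le vdist_glue_class /=.
have := chain_retract_vdist n (chain_pt u) (chain_pt v).
by rewrite !chain_retract_pt !piece_retract_id.
Qed.

End chain_theory.

Theorem tree_not_coarse_in_finite_chain (R : realType) (G : nat -> pgraph) :
  (forall n, finite_set [set: vert (G n)]) ->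
  ~ exists f : Tbar R -> (metric_graph R (chain G) : metricType R),
      coarse_embedding f.
Proof.
move=> Gfin [f /coarse_embedding_vert[g [gB gP]]].
have [C gC] := gB 1; have [D gD] := gP (C + C); have [K gK] := gB D.
pose o := g [::]; pose n := (Num.truncn (C + K) + chain_tag o)%N.
pose q := chain_pt (qpt (G n)).
have ray_near_q b : exists i, vdist R (g (nseq i b)) q <= C.
  apply: (@chain_crossing_near R G (fun i => g (nseq i b))) => [i||].
  - apply: gC; have := @vdist_edge R binary_tree (nseq i b, b).
    by rewrite /= -cats1 -[[:: b]]/(nseq 1 b) -nseqD addn1.
  - exact: leq_addl.
  - have [B oB] := chain_tag_bounded R o n Gfin; have [D' gD'] := gP B.
    exists (Num.truncn D').+1; rewrite ltnNge; apply/negP => /oB/gD'.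
    apply/negP; rewrite -ltNge; apply: lt_le_trans (tree_vdist_size _ _ _).
    by rewrite size_nseq subr0 truncnS_gt.
have [i iq] := ray_near_q false; have [j jq] := ray_near_q true.
have /gD ijD : vdist R (g (nseq i false)) (g (nseq j true)) <= C + C.
  apply: le_trans (vdist_triangle q _ _) _.
  by rewrite (vdist_sym R q) lerD.
have io : vdist R (g (nseq i false)) o <= K.
  exact: gK (le_trans (opposite_rays_vdist R false i j) ijD).
have : vdist R o q <= C + K.
  apply: le_trans (vdist_triangle (g (nseq i false)) _ _) _.
  by rewrite (vdist_sym R o) addrC lerD.
have := truncnS_gt (C + K); have := chain_tag_vdist R o q.
by rewrite chain_tag_pt eqxx -addSn natrD; lra.
Qed.

Theorem four_cycle_chain_not_coarse_in_tree (R : realType) (G : nat -> pgraph) :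
  (forall M : R, exists n, M < vdist R (ppt (G n)) (qpt (G n))) ->
  ~ exists f : (metric_graph R (chain (fun n => four_cycle_pgraph (G n)))
                : metricType R) -> Tbar R,
      coarse_embedding f.
Proof.
move=> wide [f /coarse_embedding_vert[g [gB gP]]].
have [C gC] := gB 1; have [D gD] := gP (C + C); have [K gK] := gB D.
have [M gM] := gP (Num.truncn (C + K)).+1.*2%:R; have [n Mn] := wide `|M|.
pose H k := four_cycle_pgraph (G k); pose h (x : vert (H n)) := g (chain_pt x).
have isometry := @chain_pt_isometry R H n.
have /gM : vdist R (h (ppt (H n))) (h (qpt (H n)))
    <= (Num.truncn (C + K)).+1.*2%:R.
  apply: (@four_cycle_tree_primary_bound R (G n) h C D K) =>
    [x y|x y|x y|]; rewrite -?isometry; [exact: gC|exact: gD|exact: gK|].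
  exact: truncnS_gt.
rewrite isometry; apply/negP; rewrite -ltNge.
apply: lt_le_trans (four_cycle_width R (G n)).
by have := ler_norm M; have := normr_ge0 M; lra.
Qed.

Lemma Gamma_finite n : finite_set [set: vert (Gamma_ n)].
Proof.
elim: n => [|n IH]; last exact: finite_four_cycle.
exact: (@finite_finset bool).
Qed.

Lemma Gamma_width (R : realType) n :
  2 ^+ n <= vdist R (ppt (Gamma_ n)) (qpt (Gamma_ n)).
Proof.
elim: n => [|n IH].
  pose phi (b : bool) : R := b%:R.
  have := @edge_lipschitz_vdist R Defs.interval phi false true.
  by rewrite /phi subr0; apply=> -[]; rewrite sub0r normrN1.
by rewrite exprS; apply: le_trans (four_cycle_width R _); rewrite ler_pM2l.
Qed.

Theorem proposition8 (R : realType) :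
  ~ (exists f : Tbar R -> Gamma R, coarse_embedding f) /\
  ~ (exists f : Gamma R -> Tbar R, coarse_embedding f).
Proof.
split.
  by apply: (@tree_not_coarse_in_finite_chain R) => n; exact: Gamma_finite.
apply: (@four_cycle_chain_not_coarse_in_tree R Gamma_) => M.
exists (Num.truncn M).+1; apply: lt_le_trans (truncnS_gt M) _.
apply: le_trans (Gamma_width R _).
by rewrite -natrX ler_nat ltnW// ltn_expl.
Qed.
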